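(* (1) For every odd $n\ge 3$ there is a tight irreducible affine vector space partition of length $n$ and size $\frac32n-\frac12$. (2) There is a tight irreducible affine vector space partition of length $4$ and size $6$. (3) For every even $n\ge 6$ there is a tight irreducible affine vector space partition of length $n$ and size $\frac32n-1$.
   Context: Identify $\{0,1\}^n$ with $\mathbb{F}_2^n$. An affine vector space partition of length $n$ is a partition of $\mathbb{F}_2^n$ into affine subspaces $x+V$ ($V$ a linear subspace, called the linear part); its size is the number of affine subspaces. It is irreducible if there is no subset $G$ of it with $|G|>1$ whose union is an affine subspace other than $\mathbb{F}_2^n$. It is tight if the intersection of the linear parts of all its affine subspaces is $\{0^n\}$. *)

(* Defs.v *)
From HB Require Import structures.
From mathcomp Require Import all_boot all_order all_algebra.

Set Implicit Arguments.
Unset Strict Implicit.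
Unset Printing Implicit Defensive.

Import GRing.Theory.
Local Open Scope ring_scope.

Definition affine_coset (n : nat) (x : 'rV['F_2]_n) (V : {vspace 'rV['F_2]_n})
  : {set 'rV['F_2]_n} :=
  [set x + v | v in V].

Definition is_affine_subspace (n : nat) (A : {set 'rV['F_2]_n}) : Prop :=
  exists (x : 'rV['F_2]_n) (V : {vspace 'rV['F_2]_n}), A = affine_coset x V.

Definition affine_vspace_partition (n : nat) (P : {set {set 'rV['F_2]_n}})
  : Prop :=
  partition P [set: 'rV['F_2]_n] /\
  (forall A, A \in P -> is_affine_subspace A).

Definition irreducible_partition (n : nat) (P : {set {set 'rV['F_2]_n}})
  : Prop :=
  ~ exists G : {set {set 'rV['F_2]_n}},
      [/\ G \subset P, (1 < #|G|)%N,
          is_affine_subspace (cover G) & cover G <> [set: 'rV['F_2]_n]].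

(* The linear part V of a coset x + V is determined by the coset, so the
   v satisfying the left-hand side are exactly the vectors in the intersection
   of the linear parts of the members of P. *)
Definition tight_partition (n : nat) (P : {set {set 'rV['F_2]_n}}) : Prop :=
  forall v : 'rV['F_2]_n,
    (forall (x : 'rV['F_2]_n) (V : {vspace 'rV['F_2]_n}),
        affine_coset x V \in P -> v \in V)
    <-> v = 0.

Definition tight_irreducible_avsp (n : nat) (P : {set {set 'rV['F_2]_n}})
  : Prop :=
  [/\ affine_vspace_partition P, irreducible_partition P & tight_partition P].

(* Main.v *)
Require Import Defs.
From HB Require Import structures.
From mathcomp Require Import all_boot all_order all_algebra.
From mathcomp Require Import zify ring.

(** A partition is encoded by the labelling [f] sending a point to its part, the
    parts being the fibres of [f]; in characteristic 2 a nonempty set is affine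
    iff it is closed under [x + y + z].  The recursion feeds on two parts [A] and
    [B + C], where [A], [B], [C] are parallel translates.
    One more dimension: on the layer [u = 0] keep [A | B + C], on [u = 1] use
    [B | A + C], and glue the lower [A] to the upper [B], so that every two of
    the three cells are joined exactly once; this adds one part.
    Two more dimensions: do this on the layer [t = 0], and on the layer [t = 1]
    use the parts [A + B | C], which can be split again; this adds three parts.
    A set of labels with affine union meets the layer [t = 0, u = 0], where [f]
    itself is seen, in nothing, one part or everything, and translations between
    layers settle each case.  Odd [n >= 5] is reached from a partition of length
    5 and size 7 by the second step, even [n >= 6] by one further first step;
    lengths 3, 4 and 5 are explicit. *)

Set Implicit Arguments.
Unset Strict Implicit.
Unset Printing Implicit Defensive.

Import GRing.Theory.
Local Open Scope ring_scope.

(** * Labellings of a vector space and splittable pairs of labels *)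

Definition affine_closed (V : zmodType) (S : pred V) : Prop :=
  forall x y z, S x -> S y -> S z -> S (x + y + z).

(** Surjectivity makes every fibre nonempty, so labels correspond one to one to parts and counting
    labels gives the size of the partition. *)
Record tight_irred (V : zmodType) (I : eqType) (f : V -> I) : Prop :=
  TightIrred {
    label_surj : forall i, exists x, f x = i;
    fibre_closed : forall i, affine_closed (fun x => f x == i);
    label_irred : forall G : pred I, affine_closed (fun x => G (f x)) ->
      forall i j, i != j -> G i -> G j -> forall k, G k;
    label_tight : forall v, (forall x, f (x + v) = f x) -> v = 0
  }.

(* [Some None], [Some (Some false)], [Some (Some true)] are [A], [B], [C]. *)
Definition cell (V : Type) (I : eqType) (f : V -> I) (a b : I) (h : V -> bool)
    (x : V) : option (option bool) :=
  if f x == a then Some None else if f x == b then Some (Some (h x)) else None.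

(** [cell_parallel] with [c = d] makes each cell affine; with [c] and [d] distinct it makes the
    directions of one cell preserve the others. So the cells are cosets of one linear subspace. *)
Record splits (V : zmodType) (I : eqType) (f : V -> I) (a b : I)
    (h : V -> bool) : Prop :=
  Splits {
    split_neq : a != b;
    cell_surj : forall c, exists x, cell f a b h x = Some c;
    cell_parallel : forall x y z c d, cell f a b h x = Some c ->
      cell f a b h y = Some c -> cell f a b h z = Some d ->
      cell f a b h (x + y + z) = Some d
  }.

(** * The two recursive steps *)

Section Steps.

Variables (V : zmodType) (I : eqType) (f : V -> I) (a b : I) (h : V -> bool).
Hypothesis addvv : forall x : V, x + x = 0.
Hypothesis f_ti : tight_irred f.
Hypothesis f_splits : splits f a b h.

Local Notation e := (cell f a b h).

(** * Geometry of the three parallel cells *)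

Lemma add3vv (x y : V) : x + x + y = y. Proof. by rewrite addvv add0r. Qed.

Lemma cell_None x : (e x == None) = (f x != a) && (f x != b).
Proof. by rewrite /cell; case: (f x == a); case: (f x == b). Qed.

Lemma cell_a x : e x = Some None -> f x = a.
Proof. by rewrite /cell; case: eqP => // _; case: eqP. Qed.

Lemma cell_b x d : e x = Some (Some d) -> f x = b.
Proof. by rewrite /cell; case: eqP => // _; case: eqP. Qed.

Lemma cell_old x : e x = None -> (f x != a) && (f x != b).
Proof. by move/eqP; rewrite cell_None. Qed.

Lemma old_cell x i : f x = i -> i != a -> i != b -> e x = None.
Proof. by move=> <- na nb; apply/eqP; rewrite cell_None na nb. Qed.

Lemma add3K (x y z : V) : z + (x + y + z) + x = y.
Proof. by rewrite addrC [_ + z]addrC [z + _]addrA add3vv addrA add3vv. Qed.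

(** The sum lies in the fourth coset of the affine space spanned by the cells: if it shared a cell
    with one of the three points, adding both to another point would put the third point into the
    wrong cell. This yields a label other than [a] and [b] for the irreducibility arguments. *)
Lemma cell3_old x y z : e x = Some None -> e y = Some (Some false) ->
  e z = Some (Some true) -> e (x + y + z) = None.
Proof.
move=> ex ey ez; case ew: (e (x + y + z)) => [[[]|]|] //.
- by have := cell_parallel f_splits ez ew ex; rewrite add3K ey.
- by have := cell_parallel f_splits ey ew ex; rewrite [x + y + z]addrAC add3K ez.
by have := cell_parallel f_splits ex ew ey; rewrite -[x + y + z]addrA [x + (y + z)]addrC add3K ez.
Qed.

(** Among three points of a union of two cells, two share a cell. This variant and the next cover
    the other positions of that pair. *)
Lemma cell_parallel2 x y z c d : e x = Some c -> e y = Some d ->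
  e z = Some c -> e (x + y + z) = Some d.
Proof. by move=> ex ey ez; rewrite addrAC; apply: (cell_parallel f_splits ex ez ey). Qed.

Lemma cell_parallel3 x y z c d : e x = Some d -> e y = Some c ->
  e z = Some c -> e (x + y + z) = Some d.
Proof. by move=> ex ey ez; rewrite -addrA addrC; apply: (cell_parallel f_splits ey ez ex). Qed.

(* The labels [Some b], [Some a] and [None] are the three ways of joining two
   of the six copies of cells: [B0 + C0], [A0 + B1] and [A1 + C1]. *)
Definition rotate (p : V * bool) : option I :=
  if p.2 then
    match e p.1 with
    | None => Some (f p.1)
    | Some (Some false) => Some a
    | Some _ => None
    end
  else Some (f p.1).

Lemma rotate_old p i : i != a -> i != b ->
  (rotate p == Some i) = (f p.1 == i).
Proof.
rewrite ![i == _]eq_sym => /negPf na /negPf nb.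
case: p => x [] //=; rewrite /rotate /=.
case ex: (e x) => [[[]|]|] //.
- by rewrite (cell_b ex) nb.
- by rewrite (cell_b ex) nb; apply: na.
by rewrite (cell_a ex) na.
Qed.

Lemma rotate_b p : (rotate p == Some b) = ~~ p.2 && (f p.1 == b).
Proof.
case: p => x [] //=; rewrite /rotate /=.
case ex: (e x) => [[[]|]|] //.
  exact: negPf (split_neq f_splits).
by have /andP[_ /negPf] := cell_old ex.
Qed.

Lemma rotate_a p :
  (rotate p == Some a) = (e p.1 == Some (if p.2 then Some false else None)).
Proof.
case: p => x [] //=; rewrite /rotate /=.
  case ex: (e x) => [[[]|]|] //; first by rewrite !eqxx.
  by have /andP[/negPf] := cell_old ex.
by rewrite eqE /= /cell; case: (f x == a); case: (f x == b).
Qed.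

Lemma rotate_None p : (rotate p == None) =
  p.2 && ((e p.1 == Some None) || (e p.1 == Some (Some true))).
Proof. by case: p => x [] //=; rewrite /rotate /=; case: (e x) => [[[]|]|]. Qed.

Lemma rotate_fibre i : affine_closed (fun p => rotate p == i).
Proof.
move=> [x s] [y t] [z u].
case: i => [i|]; last first.
  rewrite !rotate_None /=.
  case/andP=> -> /orP[] /eqP ex /andP[-> /orP[] /eqP ey] /andP[-> /orP[] /eqP ez] /=;
  by rewrite ?(cell_parallel f_splits ex ey ez) ?(cell_parallel2 ex ey ez)
    ?(cell_parallel3 ex ey ez).
have [->|na] := eqVneq i a.
  rewrite !rotate_a /= => /eqP ex /eqP ey /eqP ez; apply/eqP.
  by case: s t u ex ey ez => [] [] [] ex ey ez;
    rewrite ?(cell_parallel f_splits ex ey ez) ?(cell_parallel2 ex ey ez)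
    ?(cell_parallel3 ex ey ez).
have [->|nb] := eqVneq i b.
  rewrite !rotate_b /= => /andP[/negPf -> fx] /andP[/negPf -> fy] /andP[/negPf -> fz].
  exact: (fibre_closed f_ti).
by rewrite !rotate_old //; apply: (fibre_closed f_ti).
Qed.

Lemma rotate_surj i : exists p, rotate p = i.
Proof.
case: i => [i|].
  by have [x <-] := label_surj f_ti i; exists (x, false).
by have [x ex] := cell_surj f_splits None; exists (x, true); rewrite /rotate /= ex.
Qed.

(** With two labels [Some _], irreducibility of [f] on the lower layer gives all of these, and then
    [None]. With [None] and one [Some i], a second label [Some _] is produced first. *)
Lemma rotate_irred (G : pred (option I)) :
  affine_closed (fun p => G (rotate p)) ->
  forall i j, i != j -> G i -> G j -> forall k, G k.
Proof.
move=> Gcl.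
have [x ex] := cell_surj f_splits None.
have [y ey] := cell_surj f_splits (Some false).
have [z ez] := cell_surj f_splits (Some true).
have exyz := cell3_old ex ey ez; have /andP[oa ob] := cell_old exyz.
have full i j : i != j -> G (Some i) -> G (Some j) -> forall k, G k.
  move=> nij Gi Gj.
  have G0 k : G (Some k).
    apply: (label_irred f_ti (G := fun i => G (Some i))) nij Gi Gj k.
    by move=> u v w Gu Gv Gw; apply: (Gcl (u, false) (v, false) (w, false)).
  case=> [k|] //.
  (* Adding a vertical pair over [y] to the lower [z] gives the upper [z], a point of [C1], hence
     labelled [None]. *)
  have := Gcl (y, true) (y, false) (z, false).
  rewrite /rotate /= ey; move/(_ (G0 _) (G0 _) (G0 _)).
  by rewrite add3vv ez.
have one i : G None -> G (Some i) -> forall k, G k.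
  move=> GN Gi.
  have GF : G (rotate (x, true)) by rewrite /rotate /= ex.
  have GF' : G (rotate (z, true)) by rewrite /rotate /= ez.
  (* For [a], the upper three cells give the fourth coset on the upper layer; for [b], the lower [B]
     with the upper [A] and [C] gives it on the lower layer. Any other label occurs on both layers
     and brings the upper [A] down to the lower one, labelled [a]. *)
  have [eia|na] := eqVneq i a.
    apply: (full i (f (x + y + z))) => //; first by rewrite eia eq_sym.
    have := Gcl (x, true) (y, true) (z, true) GF _ GF'.
    by rewrite /rotate /= exyz ey -eia => /(_ Gi).
  have [eib|nb] := eqVneq i b.
    apply: (full i (f (x + y + z))) => //; first by rewrite eib eq_sym.
    have := Gcl (x, true) (y, false) (z, true) GF _ GF'.
    by rewrite /rotate /= (cell_b ey) -eib => /(_ Gi).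
  have [w fw] := label_surj f_ti i; have ew := old_cell fw na nb.
  apply: (full i a) => //.
  have := Gcl (w, false) (w, true) (x, true) _ _ GF.
  by rewrite /rotate /= ew fw add3vv (cell_a ex); apply.
case=> [i|] [j|] // nij Gi Gj; [exact: (full i j)|exact: (one i)|exact: (one j)].
Qed.

(** A vector changing the layer would move a lower point labelled [b] to the upper layer, where [b]
    does not occur; any other vector is settled by tightness of [f]. *)
Lemma rotate_tight v : (forall p, rotate (p + v) = rotate p) -> v = 0.
Proof.
case: v => v [] inv; last first.
  congr (_, _); apply: (label_tight f_ti) => x.
  by have [] := inv (x, false).
have [z ez] := cell_surj f_splits (Some true).
have /eqP := inv (z, false).
by rewrite {2}/rotate /= (cell_b ez) rotate_b /=.
Qed.

Theorem rotate_tight_irred : tight_irred rotate.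
Proof.
split; [exact: rotate_surj|exact: rotate_fibre|exact: rotate_irred|
  exact: rotate_tight].
Qed.

(* On the upper layer [A] and [B] are merged, not [B] and [C]: [inr true] is [C]
   and [inr false] is [A + B]. *)
Definition grow (p : V * bool * bool) : option I + bool :=
  if p.2 then
    match e p.1.1 with
    | None => inl (Some (f p.1.1))
    | Some c => inr (c == Some true)
    end
  else inl (rotate p.1).

Definition grow_split (p : V * bool * bool) : bool := f p.1.1 == b.

(** The new [A], [B], [C] are the old [C], [A], [B] on the upper layer, with the middle coordinate
    free. *)
Definition cell_cycle (c : option bool) : option bool :=
  match c with
  | None => Some true
  | Some false => None
  | Some true => Some false
  end.

Lemma grow_cell p c :
  (cell grow (inr true) (inr false) grow_split p == Some c)
  = p.2 && (e p.1.1 == Some (cell_cycle c)).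
Proof.
case: p => [[x u] [] /=]; last by [].
rewrite {1}/cell /grow /grow_split /=.
case ex: (e x) => [[[]|]|] //=; first by case: c => [[]|].
  by rewrite (cell_b ex) eqxx; case: c => [[]|].
by rewrite (cell_a ex) (negPf (split_neq f_splits)); case: c => [[]|].
Qed.

Lemma grow_splits : splits grow (inr true) (inr false) grow_split.
Proof.
split=> // [c|[[x s] s'] [[y t] t'] [[z u] u'] c d].
  have [x ex] := cell_surj f_splits (cell_cycle c).
  by exists (x, false, true); apply/eqP; rewrite grow_cell ex /=.
move=> /eqP + /eqP + /eqP +; rewrite !grow_cell /=.
move=> /andP[-> /eqP ex] /andP[-> /eqP ey] /andP[-> /eqP ez]; apply/eqP.
by rewrite grow_cell /= (cell_parallel f_splits ex ey ez).
Qed.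

Lemma grow_old p i : i != a -> i != b ->
  (grow p == inl (Some i)) = (f p.1.1 == i).
Proof.
case: p => [[x u] []] na nb; rewrite /grow /=; last exact: rotate_old.
case ex: (e x) => [c|] //.
have : e x != None by rewrite ex.
rewrite cell_None negb_and !negbK => /orP[] /eqP ->.
  by rewrite [a == i]eq_sym (negPf na).
by rewrite [b == i]eq_sym (negPf nb).
Qed.

(** On the upper layer the cells carry labels [inr _], so the labels [a], [b] and [None] survive
    only below. *)
Lemma grow_new p k : [|| k == Some a, k == Some b | k == None] ->
  (grow p == inl k) = ~~ p.2 && (rotate p.1 == k).
Proof.
case: p => [[x u] []] //= kab; rewrite /grow /=.
case ex: (e x) => [c|] //; apply/eqP => -[] ek.
have /andP[na nb] := cell_old ex.
by move: kab; rewrite -ek orbF /= !eqE /= (negPf na) (negPf nb).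
Qed.

Lemma grow_inr p d : (grow p == inr d) =
  p.2 && (if d then e p.1.1 == Some (Some true)
          else (e p.1.1 == Some None) || (e p.1.1 == Some (Some false))).
Proof.
case: p => [[x u] []] //; rewrite /grow /=.
by case: (e x) => [[[]|]|] //; case: d.
Qed.

Lemma grow_fibre i : affine_closed (fun p => grow p == i).
Proof.
case: i => [k|d] p q r; last first.
  rewrite !grow_inr; move: p q r => [[x s] s'] [[y t] t'] [[z u] u'] /=.
  move=> /andP[-> ex] /andP[-> ey] /andP[-> ez] /=.
  case: d ex ey ez.
    move=> /eqP ex /eqP ey /eqP ez; rewrite (cell_parallel f_splits ex ey ez).
    exact: eqxx.
  by move=> /orP[] /eqP ex /orP[] /eqP ey /orP[] /eqP ez;
    rewrite ?(cell_parallel f_splits ex ey ez) ?(cell_parallel2 ex ey ez)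
    ?(cell_parallel3 ex ey ez).
case kab: [|| k == Some a, k == Some b | k == None].
  rewrite !grow_new //; move: p q r => [p []] [q []] [r []] //=.
  exact: rotate_fibre.
move: kab; case: k => [i|]; last by rewrite !orbT.
rewrite orbF => /norP[na nb].
by rewrite !grow_old //; apply: (fibre_closed f_ti).
Qed.

Lemma grow_surj i : exists p, grow p = i.
Proof.
case: i => [k|[]].
- by have [p <-] := rotate_surj k; exists (p, false).
- have [x ex] := cell_surj f_splits (Some true).
  by exists (x, false, true); rewrite /grow /= ex.
have [x ex] := cell_surj f_splits None.
by exists (x, false, true); rewrite /grow /= ex.
Qed.

(** Two labels [inl _] reduce to [rotate] on the lower layer; every other pair of labels is brought
    back to that case. *)
Lemma grow_irred (G : pred (option I + bool)) :
  affine_closed (fun p => G (grow p)) ->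
  forall i j, i != j -> G i -> G j -> forall k, G k.
Proof.
move=> Gcl.
have [x ex] := cell_surj f_splits None.
have [y ey] := cell_surj f_splits (Some false).
have [z ez] := cell_surj f_splits (Some true).
have exyz := cell3_old ex ey ez; have /andP[oa ob] := cell_old exyz.
have full i j : i != j -> G (inl i) -> G (inl j) -> forall k, G k.
  move=> nij Gi Gj.
  have G0 k : G (inl k).
    apply: (rotate_irred (G := fun i => G (inl i))) nij Gi Gj k.
    by move=> u v w Gu Gv Gw; apply: (Gcl (u, false) (v, false) (w, false)).
  case=> [k|d] //.
  have [[[w u] t] gw] := grow_surj (inr d).
  (* This point has the same label on both layers, so its vertical pair lifts a lower point to the
     upper layer. *)
  have Gold t' : G (grow (x + y + z, false, t')).
    by case: t'; rewrite /grow /= ?exyz; apply: G0.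
  have := Gcl (x + y + z, false, false) (x + y + z, false, true) (w, u, false)
    (Gold _) (Gold _) (G0 _).
  have et : t = true by move: gw; case: t.
  have -> : (x + y + z, false, false) + (x + y + z, false, true) + (w, u, false)
    = (w, u, true) :> V * bool * bool by congr (_, _, _); rewrite add3vv.
  by rewrite -et gw.
have mixed d k : G (inr d) -> G (inl k) -> forall l, G l.
  move=> Gd Gk.
  (* Upper labels do not depend on the middle coordinate, so both points above [w] belong to the
     union; hence the union is invariant on the lower layer under flipping that coordinate. *)
  have [w [c ew] Gw] : exists2 w, exists c, e w = Some c &
      forall u, G (grow (w, u, true)).
    have [[[w u] []] gw] := grow_surj (inr d); last by [].
    exists w; first by case ew: (e w) gw => [c|]; [exists c|rewrite /grow /= ew].
    by move=> u'; move: gw Gd; rewrite /grow /= => ->.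
  have flip p u : G (inl (rotate (p, u))) -> G (inl (rotate (p, ~~ u))).
    move=> Gp; have := Gcl (p, u, false) (w, false, true) (w, true, true) Gp
      (Gw _) (Gw _).
    have -> // : (p, u, false) + (w, false, true) + (w, true, true)
      = (p, ~~ u, false) :> V * bool * bool.
    by congr (_, _, _); [rewrite -addrA addvv addr0|case: u {Gp}].
  have [eka|nka] := eqVneq k (Some a).
    apply: (full k None) => //; first by rewrite eka.
    have := flip x false; rewrite /rotate /= ex (cell_a ex) -eka; exact.
  have [ekb|nkb] := eqVneq k (Some b).
    apply: (full k (Some a)) => //.
    have := flip y false; rewrite /rotate /= ey (cell_b ey) -ekb; exact.
  case: k Gk nka nkb => [i|] Gk nka nkb; last first.
    apply: (full None (Some a)) => //.
    have := flip x true; rewrite /rotate /= ex (cell_a ex); exact.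
  have [v fv] := label_surj f_ti i; have ev := old_cell fv nka nkb.
  (* The vertical pair over [v] brings [w] down to the lower layer, where its label is [a] or [b],
     hence different from [i]. *)
  have := Gcl (v, false, false) (v, false, true) (w, false, true) _ _ (Gw _).
  have -> : (v, false, false) + (v, false, true) + (w, false, true)
    = (w, false, false) :> V * bool * bool by congr (_, _, _); rewrite add3vv.
  rewrite /grow /= ev /rotate /= fv => /(_ Gk Gk) Gfw.
  apply: (full (Some i) (Some (f w))) => //.
  apply/eqP => -[ei]; move: nka nkb; rewrite !eqE /= ei => na nb.
  by rewrite (old_cell erefl na nb) in ew.
case=> [i|d] [j|d'] // nij Gi Gj; [exact: (full i j)|exact: (mixed d' i)|
  exact: (mixed d j)|].
have Gd c : G (inr c) by case: d d' c nij Gi Gj => [] [] [].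
(* All three upper cells lie in the union, hence so does a point of the fourth coset, with an old
   label. *)
apply: (mixed true (Some (f (x + y + z)))) => //.
have := Gcl (x, false, true) (y, false, true) (z, false, true).
by rewrite /grow /= exyz ex ey ez; apply; apply: Gd.
Qed.

Lemma grow_tight v : (forall p, grow (p + v) = grow p) -> v = 0.
Proof.
case: v => v [] inv; last first.
  congr (_, _); apply: rotate_tight => p.
  by have [] := inv (p, false).
have [z ez] := cell_surj f_splits (Some true).
have /eqP := inv (z, false, false).
rewrite [grow (z, false, false)]/grow /= [rotate (z, false)]/rotate /=.
by rewrite (cell_b ez) grow_new ?eqxx ?orbT.
Qed.

Theorem grow_tight_irred : tight_irred grow.
Proof.
split; [exact: grow_surj|exact: grow_fibre|exact: grow_irred|exact: grow_tight].
Qed.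

End Steps.

(** * From labellings of cubes to partitions *)

(* [cube n] has dimension [n.+1], as [unit] carries no [zmodType] structure. *)
Fixpoint cube (n : nat) : zmodType :=
  if n is m.+1 then (cube m * bool)%type else bool.

Lemma cube_addvv n (x : cube n) : x + x = 0.
Proof. by elim: n x => [[] //|n IHn [x []]]; congr (_, _); apply: IHn. Qed.

Fixpoint to_cube n : 'rV['F_2]_n.+1 -> cube n :=
  match n with
  | 0 => fun v => v 0 0 == 1
  | m.+1 => fun v : 'rV['F_2]_(1 + m.+1) => (to_cube (rsubmx v), v 0 0 == 1)
  end.

Fixpoint of_cube n : cube n -> 'rV['F_2]_n.+1 :=
  match n return cube n -> 'rV['F_2]_n.+1 with
  | 0 => fun t : bool => const_mx t%:R
  | m.+1 => fun x => row_mx (const_mx (x.2 : bool)%:R : 'rV_1) (of_cube x.1)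
  end.

Lemma F2_cases (c : 'F_2) : c = 0 \/ c = 1.
Proof. by case: c => -[|[|//]] ?; [left|right]; apply: val_inj. Qed.

Lemma row_addvv n (u : 'rV['F_2]_n) : u + u = 0.
Proof.
apply/rowP => i; rewrite !mxE.
by case: (F2_cases (u 0 i)) => ->; apply: val_inj.
Qed.

Lemma F2_bitD (c d : 'F_2) : (c + d == 1) = (c == 1) + (d == 1) :> bool.
Proof. by case: (F2_cases c) (F2_cases d) => -> [] ->. Qed.

Lemma to_cubeD n (u v : 'rV['F_2]_n.+1) : to_cube (u + v) = to_cube u + to_cube v.
Proof.
elim: n u v => [|n IHn] u v /=; rewrite mxE F2_bitD // linearD IHn.
by [].
Qed.

Lemma to_cubeK n : cancel (@to_cube n) (@of_cube n).
Proof.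
have bitK (c : 'F_2) : (c == 1)%:R = c :> 'F_2 by case: (F2_cases c) => ->.
elim: n => [|n IHn] v /=.
  by apply/rowP => i; rewrite mxE bitK !ord1.
have -> : const_mx (v 0 0 == 1)%:R = lsubmx (v : 'rV_(1 + n.+1)) :> 'rV_1.
  by apply/rowP => i; rewrite !mxE bitK !ord1; congr (v _ _); apply: val_inj.
by rewrite IHn; apply: (@hsubmxK _ 1 1 n.+1 v).
Qed.

Lemma of_cubeK n : cancel (@of_cube n) (@to_cube n).
Proof.
elim: n => [|n IHn] /= => [t|[x t]]; first by rewrite mxE; case: t.
congr (_, _); first by rewrite row_mxKr IHn.
by rewrite mxE; case: splitP => // j _; rewrite mxE; case: t.
Qed.

Lemma tight_irred_comp (W V : zmodType) (I : eqType) (f : V -> I) (phi : W -> V) psi :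
  {morph phi : x y / x + y} -> cancel phi psi -> cancel psi phi ->
  tight_irred f -> tight_irred (f \o phi).
Proof.
move=> phiD phiK psiK [f_surj f_cl f_irr f_tight]; split.
- by move=> i; have [x <-] := f_surj i; exists (psi x); rewrite /= psiK.
- by move=> i x y z; rewrite /= !phiD; apply: f_cl.
- move=> G Gcl; apply: f_irr => x y z Gx Gy Gz.
  by have := Gcl (psi x) (psi y) (psi z); rewrite /= !phiD !psiK; apply.
move=> v inv; apply: (can_inj phiK).
have phi0 : phi 0 = 0 by apply: (addrI (phi 0)); rewrite -phiD !addr0.
rewrite phi0; apply: f_tight => x.
by have := inv (psi x); rewrite /= phiD psiK.
Qed.

(** * Fibres of a labelling as an affine vector space partition *)

Section Fibres.

Variable n : nat.
Local Notation rV := 'rV['F_2]_n.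

(** The differences to [x] are closed under addition, as [x + (u + w) = (x + u) + x + (x + w)].
    Since coefficients are only 0 and 1, they already contain their span. *)
Lemma affine_closed_coset (A : {set rV}) x : x \in A ->
  affine_closed (fun y => y \in A) -> is_affine_subspace A.
Proof.
move=> Ax Acl; pose X := enum [set v | x + v \in A].
have XP v : (v \in X) = (x + v \in A) by rewrite mem_enum inE.
have closed v : v \in <<X>>%VS -> x + v \in A.
  rewrite -[X]in_tupleE => /coord_span ->.
  apply: (big_ind (fun v => x + v \in A)) => [|u w Au Aw|i _]; first by rewrite addr0.
    have := Acl _ _ _ Au Ax Aw.
    by rewrite [x + u]addrC -[u + x + x]addrA row_addvv addr0 addrCA.
  case: (F2_cases (coord (in_tuple X) i v)) => ->; first by rewrite scale0r addr0.
  by rewrite scale1r -XP mem_nth.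
exists x, <<X>>%VS; apply/setP => y; apply/idP/imsetP => [Ay|[v /closed Av ->]//].
exists (y - x); last by rewrite addrC subrK.
by apply: memv_span; rewrite XP addrC subrK.
Qed.

Lemma affine_subspace_closed (A : {set rV}) :
  is_affine_subspace A -> affine_closed (fun y => y \in A).
Proof.
move=> [x [V ->]] _ _ _ /imsetP[u Vu ->] /imsetP[v Vv ->] /imsetP[w Vw ->].
apply/imsetP; exists (u + v + w); first by rewrite !memvD.
by rewrite [x + u + _]addrACA row_addvv add0r addrCA.
Qed.

Variables (I : finType) (f : rV -> I).
Hypothesis f_ti : tight_irred f.

Definition fibre (i : I) : {set rV} := [set x | f x == i].
Definition fibres : {set {set rV}} := [set fibre i | i : I].

Lemma fibre_inj : injective fibre.
Proof.
move=> i j /setP eij; have [x fx] := label_surj f_ti i.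
by have := eij x; rewrite !inE fx eqxx => /esym/eqP.
Qed.

Lemma card_fibres : #|fibres| = #|I|.
Proof. exact: card_imset fibre_inj. Qed.

Lemma fibres_partition : affine_vspace_partition fibres.
Proof.
split.
  apply/and3P; split.
  - rewrite eqEsubset subsetT; apply/subsetP => x _.
    by apply/bigcupP; exists (fibre (f x)); [apply: imset_f|rewrite inE].
  - apply/trivIsetP => _ _ /imsetP[i _ ->] /imsetP[j _ ->] neq.
    rewrite -setI_eq0; apply/eqP/setP => x; rewrite !inE.
    by apply/andP => -[/eqP ei /eqP ej]; rewrite -ei -ej eqxx in neq.
  - apply/imsetP => -[i _ /setP e0]; have [x fx] := label_surj f_ti i.
    by have := e0 x; rewrite !inE fx eqxx.
move=> _ /imsetP[i _ ->]; have [x fx] := label_surj f_ti i.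
apply: (@affine_closed_coset _ x); first by rewrite inE fx.
by move=> u v w; rewrite !inE; apply: (fibre_closed f_ti).
Qed.

Lemma fibres_irreducible : irreducible_partition fibres.
Proof.
move=> [G [/subsetP sG cG affG nT]]; apply: nT.
(* A family of fibres amounts to a predicate on labels, to which [label_irred] applies. *)
have coverG x : (x \in cover G) = (fibre (f x) \in G).
  apply/bigcupP/idP => [[A GA]|Gx]; last by exists (fibre (f x)); rewrite ?inE.
  by have /imsetP[i _ eA] := sG _ GA; rewrite eA inE => /eqP ->; rewrite -eA.
have [A [B [GA GB nAB]]] := card_gt1P cG.
have /imsetP[i _ eA] := sG _ GA; have /imsetP[j _ eB] := sG _ GB.
apply/setP => x; rewrite inE coverG.
apply: (label_irred f_ti (G := fun i => fibre i \in G) _ (i := i) (j := j)).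
- move=> u v w; rewrite -!coverG; exact: affine_subspace_closed.
- by apply: contraNneq nAB => eij; rewrite eA eB eij.
- by rewrite -eA.
by rewrite -eB.
Qed.

Lemma fibres_tight : tight_partition fibres.
Proof.
move=> v; split=> [inv|-> x V _]; last exact: mem0v.
apply: (label_tight f_ti) => x.
have Pf : fibre (f x) \in fibres by apply: imset_f.
have [y [V eV]] := fibres_partition.2 _ Pf.
have Vv : v \in V by apply: (inv y); rewrite -eV.
have /imsetP[u Vu ex] : x \in affine_coset y V by rewrite -eV inE.
have : x + v \in fibre (f x).
  by rewrite eV ex -addrA; apply: imset_f; apply: memvD.
by rewrite inE => /eqP.
Qed.

End Fibres.

Lemma cube_partition n (I : finType) (f : cube n -> I) : tight_irred f ->
  exists P : {set {set 'rV['F_2]_n.+1}}, tight_irreducible_avsp P /\ #|P| = #|I|.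
Proof.
move=> f_ti.
have g_ti := tight_irred_comp (@to_cubeD n) (@to_cubeK n) (@of_cubeK n) f_ti.
exists (fibres (f \o @to_cube n)); split; last exact: card_fibres.
split; [exact: fibres_partition|exact: fibres_irreducible|exact: fibres_tight].
Qed.

(** * Small lengths by computation *)

Fixpoint points (n : nat) : seq (cube n) :=
  if n is m.+1 then [seq (x, t) | x <- points m, t <- [:: false; true]]
  else [:: false; true].

Lemma mem_points n (x : cube n) : x \in points n.
Proof.
elim: n x => [[]//|n IHn [x t]].
have xt : (x, t) \in [seq (y, u) | y <- points n, u <- [:: false; true]].
  by apply: allpairs_f (IHn x) _; case: t.
exact: xt.
Qed.

Lemma all_pointsP n (p : pred (cube n)) : reflect (forall x, p x) (all p (points n)).
Proof. by apply: (iffP allP) => px x *; apply: px; rewrite ?mem_points. Qed.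

Lemma has_pointsP n (p : pred (cube n)) : reflect (exists x, p x) (has p (points n)).
Proof. by apply: (iffP hasP) => -[x]; exists x; rewrite ?mem_points. Qed.

Fixpoint bitseqs (k : nat) : seq bitseq :=
  if k is k'.+1 then [seq t :: s | t <- [:: false; true], s <- bitseqs k']
  else [:: [::]].

Lemma mem_bitseqs (s : bitseq) : s \in bitseqs (size s).
Proof.
elim: s => [//|t s IHs].
by apply: (allpairs_f cons) IHs; case: t.
Qed.

(* One of the three points may be fixed, as
   [x + y + z = x0 + (x0 + x + y) + z] in characteristic 2. *)
Definition affine_closedb n (S : pred (cube n)) : bool :=
  let L := filter S (points n) in
  if L is x0 :: _ then all (fun y => all (fun z => S (x0 + y + z)) L) L else true.

Lemma affine_closedP n (S : pred (cube n)) : reflect (affine_closed S) (affine_closedb S).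
Proof.
have inL x : (x \in filter S (points n)) = S x by rewrite mem_filter mem_points andbT.
rewrite /affine_closedb; case eL: (filter _ _) inL => [|x0 L] inL.
  by left=> x y z; rewrite -inL.
have Sx0 : S x0 by rewrite -inL inE eqxx.
rewrite -eL; rewrite -eL in inL; apply: (iffP allP) => [Scl|Scl y].
  have Scl0 y z : S y -> S z -> S (x0 + y + z).
    by move=> Sy Sz; rewrite -!inL in Sy Sz; have /allP/(_ z Sz) := Scl y Sy.
  move=> x y z Sx Sy Sz; have := Scl0 _ _ (Scl0 _ _ Sx Sy) Sz.
  by rewrite !addrA cube_addvv add0r.
by rewrite inL => Sy; apply/allP => z; rewrite inL; apply: Scl.
Qed.

(** The bit sequences [s] of length [k] enumerate all sets of labels, so irreducibility is an
    exhaustive check of [2^k] unions. *)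
Definition tight_irredb n k (F : cube n -> nat) : bool :=
  [&& all (fun x => F x < k)%N (points n),
      all (fun i => has (fun x => F x == i) (points n)) (iota 0 k),
      all (fun i => affine_closedb (fun x => F x == i)) (iota 0 k),
      all (fun s : bitseq => affine_closedb (fun x => nth false s (F x)) ==>
             all (fun i => all (fun j => [|| i == j, ~~ nth false s i,
               ~~ nth false s j | all id s]) (iota 0 k)) (iota 0 k)) (bitseqs k)
    & all (fun v => (v == 0) || has (fun x => F (x + v) != F x) (points n))
          (points n)].

Lemma tight_irredbP n k (F : cube n -> nat) : tight_irredb k.+1 F ->
  tight_irred (fun x => inord (F x) : 'I_k.+1).
Proof.
case/and5P => /all_pointsP Fk /allP Fsurj /allP Fcl /allP Firr /all_pointsP Ftight.
have io (i : 'I_k.+1) : val i \in iota 0 k.+1 by rewrite mem_iota ltn_ord.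
have FE x (i : 'I_k.+1) : (inord (F x) == i) = (F x == i) by rewrite -val_eqE /= inordK.
split.
- move=> i; have /has_pointsP[x Fx] := Fsurj _ (io i).
  by exists x; apply/eqP; rewrite FE.
- move=> i x y z; rewrite !FE; exact: (affine_closedP _ (Fcl _ (io i))).
- move=> G Gcl i j nij Gi Gj l.
  pose s := [seq G (inord m) | m <- iota 0 k.+1].
  have nth_s m : (m < k.+1)%N -> nth false s m = G (inord m).
    by move=> mk; rewrite (nth_map 0%N) ?size_iota // nth_iota.
  have sE (m : 'I_k.+1) : nth false s m = G m by rewrite nth_s // inord_val.
  have size_s : size s = k.+1 by rewrite size_map size_iota.
  have sk : s \in bitseqs k.+1 by rewrite -size_s mem_bitseqs.
  have scl : affine_closedb (fun x => nth false s (F x)).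
    by apply/affine_closedP => x y z; rewrite !nth_s //; apply: Gcl.
  have alls : all id s.
    have /allP/(_ _ (io i))/allP/(_ _ (io j)) := implyP (Firr s sk) scl.
    by rewrite !sE Gi Gj (inj_eq val_inj) (negPf nij).
  by move: (elimT (all_nthP false) alls l); rewrite size_s sE; apply.
move=> v inv; have /orP[/eqP // | /has_pointsP[x /eqP[]]] := Ftight v.
by have := congr1 val (inv x); rewrite /= !inordK.
Qed.

(* The coordinates of [x] are the binary digits of its index in the table. *)
Definition table n (t : seq nat) (x : cube n) : nat :=
  nth 0%N t ((fix index m : cube m -> nat :=
    match m with
    | 0 => nat_of_bool
    | m'.+1 => fun y => ((index m' y.1).*2 + y.2)%N
    end) n x).

(** In length 3 the parts are the pair [000], [111] and the three edges [01?], [?01], [1?0]. Length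
    4 uses two planes and four lines, length 5 one part of dimension 3 and six planes. *)
Definition table3 := [:: 0; 2; 1; 1; 3; 2; 3; 0]%N.
Definition table4 := [:: 0; 0; 1; 2; 3; 4; 2; 1; 3; 1; 5; 4; 1; 5; 0; 0]%N.
Definition table5 := [:: 0; 2; 3; 0; 4; 3; 2; 1; 4; 5; 3; 1; 0; 3; 5; 0; 2; 6; 1; 4; 6; 0; 0; 2; 6; 0; 0; 5; 5; 6; 1; 4]%N.

Lemma table3_tight_irred : tight_irred (fun x : cube 2 => inord (table table3 x) : 'I_4).
Proof. by apply: tight_irredbP; vm_compute. Qed.

Lemma table4_tight_irred : tight_irred (fun x : cube 3 => inord (table table4 x) : 'I_6).
Proof. by apply: tight_irredbP; vm_compute. Qed.

Definition label5 (x : cube 4) : 'I_7 := inord (table table5 x).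

Lemma label5_tight_irred : tight_irred label5.
Proof. by apply: tight_irredbP; vm_compute. Qed.

(* The part [B + C] is [0; 3; 12; 15; 21; 22; 25; 26], of which this is [C]; the
   part [A] is [7; 11; 18; 30]. *)
Definition half5 (x : cube 4) : bool :=
  table [seq (m \in [:: 3; 15; 22; 26]) : nat | m <- iota 0 32] x == 1%N.

Definition splitsb n (F : cube n -> nat) a b (h : cube n -> bool) : bool :=
  let e := cell F a b h in
  let L := filter (fun x => e x != None) (points n) in
  [&& a != b,
      all (fun c => has (fun x => e x == Some c) L)
        [:: None; Some false; Some true]
    & all (fun x => all (fun y => (e x != e y) ||
        all (fun z => e (x + y + z) == e z) L) L) L].

Lemma splitsbP n (F : cube n -> nat) a b h : splitsb F a b h -> splits F a b h.
Proof.
case/and3P=> nab /allP surj /allP par.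
have inL x c : cell F a b h x = Some c ->
    x \in filter (fun x => cell F a b h x != None) (points n).
  by move=> ex; rewrite mem_filter ex mem_points.
split=> // [c|x y z c d ex ey ez].
  have /hasP[x _ /eqP] : has (fun x => cell F a b h x == Some c)
      (filter (fun x => cell F a b h x != None) (points n)).
    by apply: surj; case: c => [[]|]; rewrite !inE.
  by exists x.
have /allP/(_ y (inL _ _ ey)) := par x (inL _ _ ex).
by rewrite ex ey eqxx /= => /allP/(_ z (inL _ _ ez))/eqP ->.
Qed.

Lemma label5_splits : splits label5 (inord 1) (inord 0) half5.
Proof.
have : splits (@table 4 table5) 1%N 0%N half5 by apply: splitsbP; vm_compute.
have tk x : (@table 4 table5 x < 7)%N.
  by move: x; apply/all_pointsP; vm_compute.
have eE x : cell label5 (inord 1) (inord 0) half5 x = cell (table table5) 1 0 half5 x.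
  by rewrite /cell /label5 -!val_eqE /= !inordK.
case=> _ surj par; split.
- by rewrite -val_eqE /= !inordK.
- by move=> c; have [x] := surj c; exists x; rewrite eE.
by move=> x y z c d; rewrite !eE; apply: par.
Qed.

(** * Assembling the odd and even lengths *)

Definition splittable (n m : nat) : Prop :=
  exists (I : finType) (f : cube n -> I) (a b : I) (h : cube n -> bool),
    [/\ tight_irred f, splits f a b h & #|I| = m].

Lemma splittable_grow n m : splittable n m -> splittable n.+2 (m + 3)%N.
Proof.
move=> [I [f [a [b [h [f_ti f_sp <-]]]]]].
exists (option I + bool)%type, (grow f a b h : cube n.+2 -> _), (inr true),
  (inr false), (grow_split f b); split.
- exact: (grow_tight_irred (@cube_addvv n) f_ti f_sp).
- exact: (grow_splits f_sp).
by rewrite card_sum card_option card_bool -addn1 -addnA.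
Qed.

Lemma splittable_iter k : splittable (4 + k.*2)%N (7 + k * 3)%N.
Proof.
elim: k => [|k IHk].
  exists 'I_7, label5, (inord 1), (inord 0), half5.
  by split; [exact: label5_tight_irred|exact: label5_splits|rewrite card_ord].
have -> : (4 + k.+1.*2 = (4 + k.*2).+2)%N by lia.
have -> : (7 + k.+1 * 3 = 7 + k * 3 + 3)%N by lia.
exact: splittable_grow.
Qed.

Lemma splittable_partition n m : splittable n m ->
  exists P : {set {set 'rV['F_2]_n.+1}}, tight_irreducible_avsp P /\ #|P| = m.
Proof.
by move=> [I [f [_ [_ [_ [f_ti _ <-]]]]]]; apply: cube_partition f_ti.
Qed.

Lemma splittable_rotate n m : splittable n m ->
  exists P : {set {set 'rV['F_2]_n.+2}}, tight_irreducible_avsp P /\ #|P| = m.+1.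
Proof.
move=> [I [f [a [b [h [f_ti f_sp <-]]]]]]; rewrite -card_option.
exact: (@cube_partition n.+1 _ _ (rotate_tight_irred (@cube_addvv n) f_ti f_sp)).
Qed.

Theorem theorem4p10 :
  (forall n : nat, odd n -> (3 <= n)%N ->
     exists P : {set {set 'rV['F_2]_n}},
       tight_irreducible_avsp P /\
       #|P|%:R = 3%:R / 2%:R * n%:R - 1 / 2%:R :> rat)
  /\ (exists P : {set {set 'rV['F_2]_4}},
        tight_irreducible_avsp P /\ #|P| = 6%N)
  /\ (forall n : nat, ~~ odd n -> (6 <= n)%N ->
        exists P : {set {set 'rV['F_2]_n}},
          tight_irreducible_avsp P /\
          #|P|%:R = 3%:R / 2%:R * n%:R - 1 :> rat).
Proof.
split; [|split].
- move=> n on; rewrite leq_eqVlt => /predU1P[<-|n3].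
    have [P [tiP cP]] := cube_partition table3_tight_irred.
    by exists P; split=> //; rewrite cP card_ord.
  (* The length is one more than the index of the cube: length [5 + 2k] has size [7 + 3k]. *)
  have -> : n = (4 + (n - 5)./2.*2).+1%N by lia.
  set k := (n - 5)./2.
  have [P [tiP cP]] := splittable_partition (splittable_iter k).
  by exists P; split=> //; rewrite cP -muln2 -addSn !natrD !natrM; field.
- have [P [tiP cP]] := cube_partition table4_tight_irred.
  by exists P; rewrite cP card_ord.
move=> n en n6.
(* One first step on top of length [5 + 2k] gives length [6 + 2k] and size [8 + 3k]. *)
have -> : n = (4 + (n - 6)./2.*2).+2%N by lia.
set k := (n - 6)./2.
have [P [tiP cP]] := splittable_rotate (splittable_iter k).
by exists P; split=> //; rewrite cP -muln2 -!addSn !natrD !natrM; field.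
Qed.
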